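(* Let $G$ be a $d$-dimensional simplicial complex, and let $L_G=\partial_d^{G}\cdot(\partial_d^{G})^T$ be its Laplacian matrix. Then, $x$ being an indeterminate, $$\sum_{(F,R,\phi,\phi')}\Lambda(\phi)\Lambda(\phi')\,x^{|R|}=\det(L_G+x\cdot \mathrm{Id}),$$ where the sum is over all bi-directed rooted forests $(F,R,\phi,\phi')$ of $G$ and $\mathrm{Id}$ is the identity matrix of dimension $|G_{d-1}|$. More generally, given indeterminates $\{w_{r,f}\}_{r\in G_{d-1},f\in G_d}$, define the weighted Laplacian matrix $L_{G,w}=\partial_d^{G,w}\cdot (\partial_d^{G})^T$, where $\partial_d^{G,w}$ is the matrix obtained from $\partial_d^{G}$ by multiplying by $w_{r,f}$ the entry corresponding to the faces $r$ and $f$. Then, for any indeterminates $\{x_{r}\}_{r\in G_{d-1}}$, $$\sum_{(F,R,\phi,\phi')}\Lambda(\phi)\Lambda(\phi')\left(\prod_{r\in \overline{R}}w_{r,\phi(r)}\right) \left(\prod_{r\in R}x_r\right)=\det(L_{G,w}+X),$$ where the sum is over all bi-directed rooted forests $(F,R,\phi,\phi')$ of $G$, and $X$ is the diagonal matrix whose rows and columns are indexed by $G_{d-1}$ and whose diagonal entry in the row indexed by $r$ is $x_r$.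
   Context: A simplicial complex on $n$ vertices is a nonempty collection $G$ of subsets of $[n]=\{1,\dots,n\}$ closed under taking subsets; its elements are called faces. A $k$-face is a face of cardinality $k+1$ (so $\emptyset$ is the $(-1)$-face), $G_k$ is the set of $k$-faces, and the dimension $d\ge 0$ of $G$ is the maximal dimension of its faces. Incidence matrix: for $k\ge 0$, $\partial_k^{G}$ is the matrix with rows indexed by $G_{k-1}$ and columns indexed by $G_k$ whose entry $\partial_k^{G}[r,f]$ is $(-1)^j$ if $f=\{v_0,\dots,v_k\}$ with $v_0<\cdots<v_k$ and $r=f\setminus\{v_j\}$, and $0$ if $r\not\subset f$. A subset $F\subseteq G_d$ is a forest of $G$ if the columns of $\partial_d^{G}$ indexed by $F$ are linearly independent (over $\mathbb{R}$). For $R\subseteq G_{d-1}$ write $\overline{R}=G_{d-1}\setminus R$. For a forest $F$, let $\partial_d^{F}$ be the submatrix of $\partial_d^{G}$ with columns indexed by $F$ and all rows indexed by $G_{d-1}$; $R$ is a root of $F$ if the rows of $\partial_d^{F}$ indexed by $\overline{R}$ form a basis of the row space of $\partial_d^{F}$. A rooted forest of $G$ is a pair $(F,R)$ where $F\subseteq G_d$ is a forest of $G$ (possibly empty) and $R\subseteq G_{d-1}$ is a root of $F$. In this case $|F|=|\overline{R}|$ and the submatrix $\partial_{\overline{R},F}$ of $\partial_d^{G}$ with rows $\overline{R}$ and columns $F$ has nonzero determinant. A fitting orientation of a rooted forest $(F,R)$ is a bijection $\phi:\overline{R}\to F$ such that $r\subset\phi(r)$ for every $r\in\overline{R}$. A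 bi-directed rooted forest of $G$ is a tuple $(F,R,\phi,\phi')$ such that $(F,R)$ is a rooted forest of $G$ and $\phi,\phi'$ are fitting orientations of $(F,R)$ (possibly equal). Signs: let $(F,R)$ be a rooted forest, $m=|F|=|\overline{R}|$, let $\alpha$ be a linear ordering of $\overline{R}$ and $\beta$ a linear ordering of $F$. For a bijection $\phi:\overline{R}\to F$ let $\pi_{\alpha,\beta,\phi}\in S_m$ be the permutation such that $\phi$ maps the $i$th face of $\overline{R}$ (in the order $\alpha$) to the $\pi_{\alpha,\beta,\phi}(i)$th face of $F$ (in the order $\beta$). For a fitting orientation $\phi$ put $$\lambda_{\alpha,\beta}(\phi)=\operatorname{sign}(\pi_{\alpha,\beta,\phi})\prod_{r\in\overline{R}}\partial_d^{G}[r,\phi(r)].$$ Let $\operatorname{sign}(\alpha,\beta)\in\{-1,1\}$ be the sign of the determinant of the matrix obtained from $\partial_{\overline{R},F}$ by ordering its rows according to $\alpha$ and its columns according to $\beta$. The sign of $\phi$ is $\Lambda(\phi)=\Lambda_{\alpha,\beta}(\phi)=\operatorname{sign}(\alpha,\beta)\cdot\lambda_{\alpha,\beta}(\phi)\in\{-1,1\}$; it does not depend on the choice of $(\alpha,\beta)$. *)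

(* Defs.v *)
From mathcomp Require Export all_boot all_order all_algebra perm.
From mathcomp Require Export reals mpoly.
From mathcomp Require Import ring.

Set Implicit Arguments.
Unset Strict Implicit.
Unset Printing Implicit Defensive.

Import Order.TTheory GRing.Theory Num.Theory.
Local Open Scope ring_scope.

(* Vertices are the elements 0 < 1 < ... < n-1 of 'I_n. *)
Definition simplicial_complex n (G : {set {set 'I_n}}) : Prop :=
  G != set0 /\ forall s t : {set 'I_n}, s \in G -> t \subset s -> t \in G.

Definition complex_dim n (G : {set {set 'I_n}}) (d : nat) : Prop :=
  (exists2 s, s \in G & #|s| = d.+1) /\ forall s, s \in G -> (#|s| <= d.+1)%N.

(* Faces are sorted by cardinality, i.e. by dimension + 1, so that the
   (-1)-face set0 is covered: for d = 0 the only ridge is set0. *)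
Definition faces n (G : {set {set 'I_n}}) (c : nat) : {set {set 'I_n}} :=
  [set s in G | #|s| == c].

(* The types G_d and G_{d-1}. *)
Notation facet G d := {f | f \in faces G d.+1}.
Notation ridge G d := {r | r \in faces G d}.

(* [enum f] lists f increasingly, so [index v (enum f)] is the j with v = v_j;
   at most one v contributes to the sum. *)
Definition incidence (K : pzRingType) n (r f : {set 'I_n}) : K :=
  \sum_(v in f | r == f :\ v) (-1) ^+ index v (enum f).

(* The submatrix of the incidence matrix with rows A and columns B. *)
Definition boundary_sub (K : pzRingType) n (G : {set {set 'I_n}}) d
    (A : {set ridge G d}) (B : {set facet G d}) : 'M[K]_(#|A|, #|B|) :=
  \matrix_(i, j) incidence K (val (enum_val i)) (val (enum_val j)).

Definition boundary (K : pzRingType) n (G : {set {set 'I_n}}) d :=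
  boundary_sub K [set: ridge G d] [set: facet G d].

Definition laplacian (K : pzRingType) n (G : {set {set 'I_n}}) d :=
  boundary K G d *m (boundary K G d)^T.

Definition forest (K : realType) n (G : {set {set 'I_n}}) d
    (F : {set facet G d}) : bool :=
  row_free (boundary_sub K [set: ridge G d] F)^T.

Definition is_root (K : realType) n (G : {set {set 'I_n}}) d
    (F : {set facet G d}) (R : {set ridge G d}) : bool :=
  row_free (boundary_sub K (~: R) F) &&
  (boundary_sub K (~: R) F == boundary_sub K [set: ridge G d] F)%MS.

Definition rooted_forest (K : realType) n (G : {set {set 'I_n}}) d
    (F : {set facet G d}) (R : {set ridge G d}) : bool :=
  forest K F && is_root K F R.

Definition fitting_orientation n (G : {set {set 'I_n}}) d
    (F : {set facet G d}) (R : {set ridge G d})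
    (phi : {ffun {r in ~: R} -> {f in F}}) : bool :=
  [&& injectiveb phi, [forall f : {f in F}, f \in codom phi]
    & [forall r : {r in ~: R}, val (val r) \subset val (val (phi r))]].

Definition bidirected_rooted_forest (K : realType) n (G : {set {set 'I_n}}) d
    (F : {set facet G d}) (R : {set ridge G d})
    (phi phi' : {ffun {r in ~: R} -> {f in F}}) : bool :=
  [&& rooted_forest K F R, fitting_orientation phi & fitting_orientation phi'].

Definition linear_ordering (T : finType) m (alpha : m.-tuple T) : bool :=
  uniq alpha && [forall x, x \in alpha].

(* The permutation pi_{alpha,beta,phi}: it is unique when alpha and beta are
   linear orderings and phi is a bijection (the default 1 is then unused). *)
Definition order_perm (S T : finType) m (alpha : m.-tuple S) (beta : m.-tuple T)
    (phi : {ffun S -> T}) : 'S_m :=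
  odflt 1%g [pick s : 'S_m |
    [forall i, phi (tnth alpha i) == tnth beta (s i)]].

Definition lambda (K : realType) n (G : {set {set 'I_n}}) d
    (F : {set facet G d}) (R : {set ridge G d}) m
    (alpha : m.-tuple {r in ~: R}) (beta : m.-tuple {f in F})
    (phi : {ffun {r in ~: R} -> {f in F}}) : K :=
  (-1) ^+ order_perm alpha beta phi *
  \prod_(r : {r in ~: R}) incidence K (val (val r)) (val (val (phi r))).

Definition order_sign (K : realType) n (G : {set {set 'I_n}}) d
    (F : {set facet G d}) (R : {set ridge G d}) m
    (alpha : m.-tuple {r in ~: R}) (beta : m.-tuple {f in F}) : K :=
  Num.sg (\det (\matrix_(i < m, j < m)
    incidence K (val (val (tnth alpha i))) (val (val (tnth beta j))))).

Definition Lambda_ordered (K : realType) n (G : {set {set 'I_n}}) d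
    (F : {set facet G d}) (R : {set ridge G d}) m
    (alpha : m.-tuple {r in ~: R}) (beta : m.-tuple {f in F})
    (phi : {ffun {r in ~: R} -> {f in F}}) : K :=
  order_sign K alpha beta * lambda K alpha beta phi.

(* The sign computed with an arbitrarily chosen pair of linear orderings. Such
   a pair exists for every rooted forest ([linear_orderings_exist]) and all of
   them give the same sign ([LambdaE]). *)
Definition Lambda (K : realType) n (G : {set {set 'I_n}}) d
    (F : {set facet G d}) (R : {set ridge G d})
    (phi : {ffun {r in ~: R} -> {f in F}}) : K :=
  if [pick ab : #|F|.-tuple {r in ~: R} * #|F|.-tuple {f in F} |
        linear_ordering ab.1 && linear_ordering ab.2] is Some ab
  then Lambda_ordered K ab.1 ab.2 phi else 0.

(* The set of names of the indeterminates w_{r,f} and x_r. *)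
Notation indet G d := ((ridge G d * facet G d) + ridge G d)%type.

Definition wvar (K : nzRingType) n (G : {set {set 'I_n}}) d
    (r : ridge G d) (f : facet G d) : {mpoly K[#|{: indet G d}|]} :=
  'X_(enum_rank (inl (r, f) : indet G d)).

Definition xvar (K : nzRingType) n (G : {set {set 'I_n}}) d
    (r : ridge G d) : {mpoly K[#|{: indet G d}|]} :=
  'X_(enum_rank (inr r : indet G d)).

Definition weighted_boundary (K : nzRingType) n (G : {set {set 'I_n}}) d :=
  \matrix_(i < #|[set: ridge G d]|, j < #|[set: facet G d]|)
    (wvar K (enum_val i) (enum_val j) * (boundary K G d i j)%:MP).

Definition weighted_laplacian (K : nzRingType) n (G : {set {set 'I_n}}) d :=
  weighted_boundary K G d *m
  (map_mx (@mpolyC #|{: indet G d}| K) (boundary K G d))^T.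

Definition xdiag (K : nzRingType) n (G : {set {set 'I_n}}) d :=
  diag_mx (\row_(i < #|[set: ridge G d]|) xvar K (enum_val i)).

Lemma linear_orderings_exist (K : realType) n (G : {set {set 'I_n}}) d
    (F : {set facet G d}) (R : {set ridge G d}) :
  rooted_forest K F R ->
  exists (alpha : #|F|.-tuple {r in ~: R}) (beta : #|F|.-tuple {f in F}),
    linear_ordering alpha && linear_ordering beta.
Proof.
move=> /andP[ff /andP[fR /eqmxP eR]].
have cE : #|~: R| = #|F|.
  move: ff fR; rewrite /forest /row_free mxrank_tr -(eR : (_ :=: _)%MS).
  by move=> /eqP eF /eqP eR'; rewrite -eR' eF.
have sF : size (enum {: {f in F}}) == #|F| by rewrite -cardE card_sig.
have sR : size (enum {: {r in ~: R}}) == #|F| by rewrite -cardE card_sig cE.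
exists (Tuple sR), (Tuple sF); rewrite /linear_ordering /= !enum_uniq /=.
by apply/andP; split; apply/forallP => x; rewrite mem_enum.
Qed.

Lemma reorder (T : finType) m (a b : m.-tuple T) :
  linear_ordering a -> linear_ordering b ->
  exists s : 'S_m, forall i, tnth b i = tnth a (s i).
Proof.
move=> /andP[ua /forallP fa] /andP[ub _].
have fb : b =i a.
  by have [|| _ ] := uniq_min_size ub (s2 := a); [move=> x _ | rewrite !size_tuple|].
have /tuple_permP[s sE] : perm_eq b a by apply: uniq_perm.
by exists s => i; rewrite (tnth_nth (tnth a i)) sE -tnth_nth tnth_mktuple.
Qed.

Lemma order_permE (S T : finType) m (a : m.-tuple S) (b : m.-tuple T)
    (phi : {ffun S -> T}) (s : 'S_m) :
  linear_ordering b -> (forall i, phi (tnth a i) = tnth b (s i)) ->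
  order_perm a b phi = s.
Proof.
move=> /andP[ub _] sE; rewrite /order_perm; case: pickP => [t /forallP tE|].
  apply/permP => i; have /eqP := tE i; rewrite sE.
  by move/(tuple_uniqP _ ub) => ->.
by move=> /(_ s) /negP[]; apply/forallP => i; rewrite sE.
Qed.

Lemma order_perm_spec (S T : finType) m (a : m.-tuple S) (b : m.-tuple T)
    (phi : {ffun S -> T}) :
  linear_ordering a -> linear_ordering b -> injective phi ->
  forall i, phi (tnth a i) = tnth b (order_perm a b phi i).
Proof.
move=> /andP[ua _] lb injphi.
have lpa : linear_ordering [tuple of map phi a].
  rewrite /linear_ordering map_inj_uniq ?ua //=.
  case/andP: lb => ub /forallP fb; apply/forallP => x.
  have uc : uniq (map phi a) by rewrite map_inj_uniq.
  have [||_ ->] := uniq_min_size uc (s2 := b); last exact: fb.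
    by move=> y _; exact: fb.
  by rewrite size_map !size_tuple.
have [s sE] := reorder lb lpa.
by move=> i; rewrite (order_permE (s := s)) // => [|j];
  rewrite -sE tnth_map.
Qed.

Lemma Lambda_ordered_indep (K : realType) n (G : {set {set 'I_n}}) d
    (F : {set facet G d}) (R : {set ridge G d}) m
    (a a' : m.-tuple {r in ~: R}) (b b' : m.-tuple {f in F})
    (phi : {ffun {r in ~: R} -> {f in F}}) :
  linear_ordering a -> linear_ordering b ->
  linear_ordering a' -> linear_ordering b' -> injective phi ->
  Lambda_ordered K a' b' phi = Lambda_ordered K a b phi.
Proof.
move=> la lb la' lb' injphi.
have [s sE] := reorder la la'; have [t tE] := reorder lb lb'.
have pE := order_perm_spec la lb injphi.
set p := order_perm a b phi in pE.
have pE' : order_perm a' b' phi = (s * p * t^-1)%g.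
  by apply: order_permE => // i; rewrite sE pE tE !permM permKV.
rewrite /Lambda_ordered /lambda pE' /order_sign.
set M := \matrix_(i, j) _; set M' := \matrix_(i, j) _.
have -> : M = row_perm s (col_perm t M').
  by apply/matrixP => i j; rewrite !mxE sE tE.
rewrite row_permE col_permE !det_mulmx !det_perm !odd_permM odd_permV.
have sgS (u : 'S_m) : Num.sg ((-1) ^+ u : K) = (-1) ^+ u.
  by case: (odd_perm u); rewrite ?sgrN1 ?sgr1.
rewrite !sgrM !sgS (signr_addb K (odd_perm s (+) odd_perm p) (odd_perm t)).
rewrite (signr_addb K (odd_perm s) (odd_perm p)) -/p.
have eS (u : bool) : (-1) ^+ u * (-1) ^+ u = 1 :> K by case: u; rewrite ?mulrNN ?mulr1.
have := eS (odd_perm s); have := eS (odd_perm t).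
move: ((-1) ^+ odd_perm s) ((-1) ^+ odd_perm t) ((-1) ^+ odd_perm p).
move: (Num.sg _) (\prod_r _) => D P S T Q TT SS.
transitivity (S * S * (T * T) * (D * (Q * P))); last by rewrite TT SS !mul1r.
by ring.
Qed.

Lemma LambdaE (K : realType) n (G : {set {set 'I_n}}) d
    (F : {set facet G d}) (R : {set ridge G d})
    (alpha : #|F|.-tuple {r in ~: R}) (beta : #|F|.-tuple {f in F})
    (phi : {ffun {r in ~: R} -> {f in F}}) :
  linear_ordering alpha -> linear_ordering beta -> fitting_orientation phi ->
  Lambda K phi = Lambda_ordered K alpha beta phi.
Proof.
move=> la lb /and3P[/injectiveP injphi _ _]; rewrite /Lambda.
case: pickP => [[a b] /= /andP[la' lb']|/(_ (alpha, beta))].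
  exact: Lambda_ordered_indep.
by rewrite /= la lb.
Qed.

(* Main.v *)
(* A principal-minor expansion and the Cauchy-Binet formula write
   det(L_{G,w} + X) as the sum over R and F of prod_{r in R} x_r times the
   product of the weighted and the unweighted determinants of the square
   submatrices with rows ~: R and columns F. Only rooted forests give a nonzero
   term. Expanding a determinant over bijections, the sum of the Lambda phi is
   |det| and the weighted sum of the Lambda phi is the weighted determinant
   times the same sign, so that the two signs cancel. *)
Require Import Defs.

Set Implicit Arguments.
Unset Strict Implicit.
Unset Printing Implicit Defensive.

Import Order.TTheory GRing.Theory Num.Theory.
Local Open Scope ring_scope.

(** * Determinants of matrices indexed by a finite type *)

(* The enumeration used is irrelevant, see [fdetE]. *)
Definition fdet (A : comNzRingType) (I : finType) (M : I -> I -> A) : A :=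
  \det (\matrix_(i < #|I|, j < #|I|) M (enum_val i) (enum_val j)).

(** Two enumerations differ by one permutation acting on both rows and columns, so its sign occurs
    twice and cancels. *)
Lemma fdetE (A : comNzRingType) (I : finType) p (e : 'I_p -> I)
    (M : I -> I -> A) :
  injective e -> p = #|I| ->
  \det (\matrix_(i < p, j < p) M (e i) (e j)) = fdet M.
Proof.
move=> e_inj p_card; subst p; rewrite /fdet.
have s_inj : injective (enum_rank \o e).
  by apply: inj_comp => //; exact: enum_rank_inj.
set N := (X in _ = \det X).
have -> : \matrix_(i, j) M (e i) (e j) =
    row_perm (perm s_inj) (col_perm (perm s_inj) N).
  by apply/matrixP => i j; rewrite !mxE !permE /= !enum_rankK.
rewrite row_permE col_permE !det_mulmx !det_perm odd_permV mulrCA mulrA.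
by case: (odd_perm _); rewrite ?(mulN1r, mulrN1, mulr1, mul1r, opprK).
Qed.

Lemma fdet_rmorph (A B : comNzRingType) (c : {rmorphism A -> B}) (I : finType)
    (M : I -> I -> A) :
  fdet (fun i j => c (M i j)) = c (fdet M).
Proof.
rewrite /fdet -det_map_mx; congr (\det _).
by apply/matrixP => i j; rewrite !mxE.
Qed.

Lemma big_enum_rank (A : Type) (idx : A) (op : Monoid.com_law idx)
    (I : finType) (H : 'I_#|I| -> A) :
  \big[op/idx]_i H i = \big[op/idx]_(t : I) H (enum_rank t).
Proof. by rewrite (reindex _ (onW_bij _ (enum_rank_bij I))). Qed.

(* Expanding along [R] replaces the rows of [R] by rows [x i *+ (i == j)];
   listing [~: R] before [R] makes the matrix block upper triangular. *)
Lemma fdet_add_diag (A : comNzRingType) (I : finType) (M : I -> I -> A)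
    (x : I -> A) :
  fdet (fun i j => M i j + x i *+ (i == j)) =
  \sum_(R : {set I})
    fdet (fun i j : {i in ~: R} => M (val i) (val j)) * \prod_(i in R) x i.
Proof.
transitivity (\sum_(R : {set I})
    fdet (fun i j => if i \in R then x i *+ (i == j) else M i j)).
  rewrite /fdet /determinant exchange_big; apply: eq_bigr => s _ /=.
  rewrite -big_distrr /=; congr (_ * _).
  (* In [bigA_distr], [R] records where the first summand is chosen; the swap makes that the
     diagonal one. *)
  under eq_bigr do rewrite mxE addrC.
  rewrite big_enum_rank bigA_distr; apply: eq_bigr => R _.
  rewrite big_enum_rank; apply: eq_bigr => i _.
  by rewrite mxE enum_rankK.
apply: eq_bigr => R _.
pose e (k : 'I_(#|{: {i in ~: R}}| + #|R|)) : I :=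
  match split k with inl i => val (enum_val i) | inr i => enum_val i end.
have el i : e (lshift _ i) = val (enum_val i).
  by rewrite /e (unsplitK (inl _ i)).
have er i : e (rshift _ i) = enum_val i by rewrite /e (unsplitK (inr _ i)).
have lN i : (e (lshift _ i) \in R) = false.
  by rewrite el; apply/negbTE; have := valP (enum_val i); rewrite inE.
have rR i : e (rshift _ i) \in R by rewrite er enum_valP.
have e_inj : injective e.
  move=> i j; rewrite -[i]splitK -[j]splitK.
  case: (split i) (split j) => [k|k] [l|l] //= ekl.
  - by move: ekl; rewrite !el => /val_inj/enum_val_inj ->.
  - by have := lN k; rewrite ekl rR.
  - by have := lN l; rewrite -ekl rR.
  - by move: ekl; rewrite !er => /enum_val_inj ->.
rewrite -(fdetE (e := e)) //; last by rewrite card_sig addnC cardsC.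
set N := \matrix_(i, j) _.
rewrite -[N]submxK.
have -> : dlsubmx N = 0.
  apply/matrixP => i j; rewrite !mxE rR.
  by case: eqP => // eij; have := lN j; rewrite -eij rR.
rewrite det_ublock; congr (_ * _).
  by congr (\det _); apply/matrixP => i j; rewrite !mxE lN !el.
rewrite det_trig; last first.
  apply/is_trig_mxP => i j ij; rewrite !mxE rR !er (inj_eq enum_val_inj).
  by case: eqP ij => // ->; rewrite ltnn.
rewrite [RHS]big_enum_val; apply: eq_bigr => i _.
by rewrite !mxE rR eqxx er.
Qed.

(** * The Cauchy-Binet formula *)

(** This is [fitting_orientation] without the inclusions, since determinant expansions range over
    all bijections. *)
Definition bijb (I J : finType) (h : {ffun I -> J}) : bool :=
  injectiveb h && [forall y, y \in codom h].

(** The minor of [f] stays expanded into its Leibniz terms, so that each [h] can become an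
    orientation; the sign of a term is absorbed by listing the columns of [g] along [h]. *)
Lemma fdet_Cauchy_Binet (A : comNzRingType) (I J : finType)
    (f g : I -> J -> A) :
  fdet (fun i k => \sum_j f i j * g k j) =
  \sum_(F : {set J}) \sum_(h : {ffun I -> {j in F}} | bijb h)
    (\prod_i f i (val (h i))) * fdet (fun i k => g i (val (h k))).
Proof.
transitivity (\sum_(h : {ffun I -> J} | injectiveb h)
    (\prod_i f i (h i)) * fdet (fun i k => g i (h k))).
  transitivity (\sum_(h : {ffun I -> J})
      (\prod_i f i (h i)) * fdet (fun i k => g i (h k))).
    (* After transposition the factors are [g (s i) (h i)], as in the expansion of the left-hand
       side. *)
    under [RHS]eq_bigr => h _ do
      rewrite /fdet -det_tr /determinant big_distrr /=.
    rewrite [RHS]exchange_big; apply: eq_bigr => s _ /=.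
    rewrite big_enum_rank.
    under eq_bigr do rewrite mxE enum_rankK.
    rewrite bigA_distr_bigA big_distrr; apply: eq_bigr => h _ /=.
    rewrite big_split /= mulrCA; congr (_ * (_ * _)).
    rewrite [RHS]big_enum_rank; apply: eq_bigr => i _.
    by rewrite !mxE enum_rankK.
  (* A non-injective [h] repeats a column of [g], so its determinant vanishes. *)
  rewrite (bigID (fun h : {ffun I -> J} => injectiveb h)) /=.
  rewrite [X in _ + X]big1 ?addr0 // => h.
  move=> /injectivePn[i [k ik eik]]; rewrite /fdet -det_tr.
  rewrite (determinant_alternate (i1 := enum_rank i) (i2 := enum_rank k));
    rewrite ?mulr0 //.
    by rewrite (inj_eq enum_rank_inj).
  by move=> l; rewrite !mxE !enum_rankK eik.
rewrite (partition_big (fun h : {ffun I -> J} => [set h i | i : I]) xpredT) //=.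
apply: eq_bigr => F _.
pose extend (h : {ffun I -> {j in F}}) : {ffun I -> J} := [ffun i => val (h i)].
(* The partial inverse of [extend] restricts the codomain of [h] to [F], which is possible when the
   image of [h] is [F]. *)
rewrite (reindex_omap extend (fun h => [pick h' | extend h' == h])); last first.
  move=> h /andP[_ /eqP hF].
  have Fh i : h i \in F by rewrite -hF imset_f.
  case: pickP => [h' /eqP <-//|/(_ [ffun i => exist _ (h i) (Fh i)])/eqP[]].
  by apply/ffunP => i; rewrite !ffunE.
have extend_inj : injective extend.
  move=> h h' /ffunP ehh'; apply/ffunP => i.
  by have := ehh' i; rewrite !ffunE => /val_inj.
apply: eq_big => [h|h _].
  have -> : [pick h' | extend h' == extend h] == Some h.
    by case: pickP => [h' /eqP/extend_inj->//|/(_ h)]; rewrite eqxx.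
  rewrite andbT; congr (_ && _).
    apply/injectiveP/injectiveP => hi i k.
      by move=> hik; apply: hi; rewrite !ffunE hik.
    by rewrite !ffunE => /val_inj/hi.
  apply/eqP/forallP => [hF y|hsurj].
    have : val y \in [set extend h i | i : I] by rewrite hF (valP y).
    by case/imsetP => i _; rewrite ffunE => /val_inj->; exact: codom_f.
  apply/setP => j; apply/imsetP/idP => [[i _ ->]|Fj].
    by rewrite ffunE (valP (h i)).
  have /codomP[i hi] := hsurj (exist _ j Fj).
  by exists i; rewrite // ffunE -hi.
congr (_ * _); first by apply: eq_bigr => i _; rewrite ffunE.
by congr (\det _); apply/matrixP => i k; rewrite !mxE ffunE.
Qed.

(** * Rooted forests and signs of orientations *)

Lemma incidence_eq0 (K : pzRingType) n (r f : {set 'I_n}) :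
  ~~ (r \subset f) -> incidence K r f = 0.
Proof.
move=> rf; rewrite /incidence big_pred0 // => v.
by apply/negP => /andP[_ /eqP rE]; rewrite rE subD1set in rf.
Qed.

Section RootedForests.
Context (K : realType) (n : nat) (G : {set {set 'I_n}}) (d : nat).
Context (F : {set facet G d}) (R : {set ridge G d}).
Local Notation assignment := {ffun {r in ~: R} -> {f in F}}.
Implicit Type phi : assignment.

Let entry (r : {r in ~: R}) (f : {f in F}) : K :=
  incidence K (val (val r)) (val (val f)).

Lemma fitting_bijb phi :
  fitting_orientation phi =
    bijb phi && [forall r : {r in ~: R}, val (val r) \subset val (val (phi r))].
Proof. by rewrite /fitting_orientation /bijb -andbA. Qed.

Lemma prod_entry_eq0 phi :
  ~~ [forall r : {r in ~: R}, val (val r) \subset val (val (phi r))] ->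
  \prod_r entry r (phi r) = 0.
Proof.
case/forallPn => r /incidence_eq0 r0; apply/eqP/prodf_eq0.
by exists r => //; rewrite /entry r0.
Qed.

Lemma bijb_card phi : bijb phi -> #|{: {r in ~: R}}| = #|{: {f in F}}|.
Proof.
case/andP => /injectiveP phi_inj /forallP phi_surj.
rewrite -(card_codom phi_inj); apply: eq_card => f.
by rewrite phi_surj.
Qed.

(** The bijection makes [boundary_sub K (~: R) F] square and the nonzero minor makes it invertible.
    Its rows are then free and span the whole space, and so do the rows of all ridges together. *)
Lemma fdet_neq0_rooted phi :
  bijb phi -> fdet (fun r s => entry r (phi s)) != 0 -> rooted_forest K F R.
Proof.
move=> phi_bij; rewrite /fdet; set N := (X in \det X) => detN.
have cRF : #|~: R| = #|F| by have := bijb_card phi_bij; rewrite !card_sig.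
(* [a] and [b] relist the rows and columns of [B], the columns along [phi], so that [\rank N] is at
   most [\rank B]. *)
pose a (i : 'I_#|{: {r in ~: R}}|) : 'I_#|~: R| :=
  enum_rank_in (valP (enum_val i)) (val (enum_val i)).
pose b (i : 'I_#|{: {r in ~: R}}|) : 'I_#|F| :=
  enum_rank_in (valP (phi (enum_val i))) (val (phi (enum_val i))).
set B := boundary_sub K (~: R) F.
have NE : N = rowsub a (colsub b B).
  apply/matrixP => i j; rewrite !mxE /entry /a /b.
  by rewrite !enum_rankK_in ?(valP (enum_val i)) ?(valP (phi _)).
have rB : (#|F| <= \rank B)%N.
  have rN : \rank N = #|F| by rewrite mxrank_unit ?card_sig // unitmxE unitfE.
  rewrite -[leqLHS]rN NE (leq_trans (mxrankS (rowsub_sub _ _))) //.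
  by rewrite -mxrank_tr trmx_mxsub -[leqRHS]mxrank_tr mxrankS ?rowsub_sub.
have B_free : row_free B by rewrite /row_free eqn_leq rank_leq_row [leqLHS]cRF.
have B_full : row_full B by rewrite /row_full eqn_leq rank_leq_col.
have BS : (B <= boundary_sub K [set: ridge G d] F)%MS.
  pose c (i : 'I_#|~: R|) : 'I_#|[set: ridge G d]| :=
    enum_rank_in (in_setT (enum_val i)) (enum_val i).
  suff -> : B = rowsub c (boundary_sub K [set: ridge G d] F).
    exact: rowsub_sub.
  by apply/matrixP => i j; rewrite !mxE enum_rankK_in ?in_setT.
have S_full : row_full (boundary_sub K [set: ridge G d] F).
  by rewrite -sub1mx (submx_trans _ BS) // sub1mx.
rewrite /rooted_forest /is_root -/B B_free BS submx_full // !andbT.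
by rewrite /forest /row_free mxrank_tr.
Qed.

(* With [alpha] any ordering of [~: R] and [beta := phi \o alpha], the
   permutation of [phi] is trivial and the sign of the determinant cancels
   in the product with [Lambda phi']. *)
Lemma Lambda_mul_sum phi : fitting_orientation phi ->
  Lambda K phi *
    \sum_(phi' : assignment | fitting_orientation phi') Lambda K phi' =
  \prod_r entry r (phi r) * fdet (fun r s => entry r (phi s)).
Proof.
move=> phi_fit; have := phi_fit; rewrite fitting_bijb => /andP[phi_bij _].
have /andP[/injectiveP phi_inj /forallP phi_surj] := phi_bij.
have cRF := bijb_card phi_bij.
have szR : size (enum {: {r in ~: R}}) == #|F|.
  by rewrite -cardE cRF card_sig.
pose alpha := Tuple szR.
have alpha_lin : linear_ordering alpha.
  by rewrite /linear_ordering enum_uniq; apply/forallP => r; rewrite mem_enum.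
pose beta : #|F|.-tuple {f in F} := [tuple of map phi alpha].
have betaE i : tnth beta i = phi (tnth alpha i) by rewrite tnth_map.
have beta_lin : linear_ordering beta.
  rewrite /linear_ordering map_inj_uniq ?enum_uniq //=.
  apply/forallP => f; have /codomP[r ->] := phi_surj f.
  by rewrite map_f ?mem_enum.
have alpha_inj : injective (tnth alpha) by apply/tuple_uniqP; rewrite enum_uniq.
have alpha_bij : bijective (tnth alpha).
  by apply: inj_card_bij => //; rewrite card_ord cRF card_sig.
have [rk alphaK rkK] := alpha_bij.
set N := fdet _; pose D := Num.sg N.
have det_ab : \det (\matrix_(i < #|F|, j < #|F|)
    entry (tnth alpha i) (tnth beta j)) = N.
  rewrite /N -(fdetE (e := tnth alpha)) ?cRF ?card_sig //.
  by congr (\det _); apply/matrixP => i j; rewrite !mxE betaE.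
have LambdaN phi' : fitting_orientation phi' -> Lambda K phi' =
    D * ((-1) ^+ order_perm alpha beta phi' * \prod_r entry r (phi' r)).
  move=> fit'; rewrite (LambdaE _ alpha_lin beta_lin fit').
  by rewrite /Lambda_ordered /order_sign det_ab.
(* Bijections that are not fitting have a zero product of entries, so the sum extends to all
   bijections and becomes the Leibniz expansion of [N]. *)
have -> : \sum_(phi' : assignment | fitting_orientation phi')
    Lambda K phi' = D * N.
  under eq_bigr => phi' fit' do rewrite LambdaN //.
  rewrite -big_distrr /=; congr (_ * _).
  transitivity (\sum_(phi' : assignment | bijb phi')
      (-1) ^+ order_perm alpha beta phi' * \prod_r entry r (phi' r)).
    rewrite [RHS](bigID (fun phi' : assignment =>
      [forall r : {r in ~: R}, val (val r) \subset val (val (phi' r))])) /=.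
    rewrite [X in _ = _ + X]big1 ?addr0.
      by apply: eq_bigl => phi'; rewrite fitting_bijb.
    by move=> phi' /andP[_ /prod_entry_eq0->]; rewrite mulr0.
  (* The inverse of [order_perm alpha beta] on bijections. *)
  pose of_perm (s : 'S_#|F|) : assignment :=
    [ffun r => tnth beta (s (rk r))].
  have of_permE s : order_perm alpha beta (of_perm s) = s.
    by apply: order_permE => // i; rewrite ffunE alphaK.
  rewrite (reindex_onto of_perm (order_perm alpha beta)) /=; last first.
    move=> phi' /andP[/injectiveP inj' _]; apply/ffunP => r.
    by rewrite ffunE -[in RHS](rkK r) (order_perm_spec alpha_lin beta_lin).
  rewrite -det_ab; apply: eq_big => [s|s _].
    rewrite of_permE eqxx andbT; apply/andP; split.
      apply/injectiveP => r r'; rewrite !ffunE !betaE.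
      by move=> /phi_inj/alpha_inj/perm_inj/(can_inj rkK).
    apply/forallP => f; have /codomP[r ->] := phi_surj f.
    apply/codomP; exists (tnth alpha (s^-1%g (rk r))).
    by rewrite ffunE alphaK permKV betaE rkK.
  rewrite of_permE; congr (_ * _).
  rewrite (reindex _ (onW_bij _ alpha_bij)); apply: eq_bigr => i _.
  by rewrite ffunE mxE alphaK.
have order1 : order_perm alpha beta phi = 1%g.
  by apply: order_permE => // i; rewrite perm1 betaE.
rewrite LambdaN // order1 odd_perm1 expr0 mul1r mulrACA -expr2 sqr_sg.
(* [D ^+ 2] is 1 except when [N = 0], where both sides vanish. *)
have [N0|N0] := eqVneq N 0; first by rewrite N0 !(mulr0, mul0r).
by rewrite mul1r.
Qed.

(** The weights follow [phi] alone, so for fixed [phi] the sum over [phi'] collapses by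
    [Lambda_mul_sum]. *)
Lemma sum_bidirected (A : comNzRingType) (c : {rmorphism K -> A})
    (w : ridge G d -> facet G d -> A) :
  \sum_(phi : assignment)
  \sum_(phi' : assignment | bidirected_rooted_forest K phi phi')
    c (Lambda K phi * Lambda K phi') * \prod_r w (val r) (val (phi r)) =
  \sum_(phi : assignment | bijb phi)
    (\prod_r (w (val r) (val (phi r)) * c (entry r (phi r)))) *
    fdet (fun r s => c (entry r (phi s))).
Proof.
rewrite [RHS]big_mkcond; apply: eq_bigr => phi _ /=.
rewrite fdet_rmorph big_split /= -rmorph_prod /bidirected_rooted_forest.
have [fit|nfit] /= := boolP (fitting_orientation phi); last first.
  rewrite big_pred0 => [|phi']; last by rewrite andbF.
  case: ifP => // phi_bij.
  rewrite fitting_bijb phi_bij in nfit.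
  by rewrite prod_entry_eq0 // rmorph0 mulr0 mul0r.
have phi_bij : bijb phi by move: fit; rewrite fitting_bijb => /andP[].
rewrite phi_bij.
transitivity (c (\prod_r entry r (phi r) * fdet (fun r s => entry r (phi s))) *
    \prod_r w (val r) (val (phi r))); last by rewrite rmorphM mulrC mulrA.
rewrite -Lambda_mul_sum // big_distrr /= rmorph_sum big_distrl /=.
(* If [(F, R)] is not a rooted forest, the sum over [phi'] is empty, and the minor vanishes as
   well. *)
have [//|nrooted] := boolP (rooted_forest K F R).
rewrite big_pred0 // -big_distrl -rmorph_sum -big_distrr /= Lambda_mul_sum //.
have -> : fdet (fun r s => entry r (phi s)) = 0.
  by apply: contraNeq nrooted; exact: fdet_neq0_rooted.
by rewrite mulr0 rmorph0 mul0r.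
Qed.

End RootedForests.

(** * Assembling the determinant of the Laplacian *)

(** The ring [A] and the morphism [c] are left general so that univariate and multivariate
    polynomials are both instances. *)
Lemma sum_bidirected_det (K : realType) n (G : {set {set 'I_n}}) d
    (A : comNzRingType) (c : {rmorphism K -> A})
    (w : ridge G d -> facet G d -> A) (x : ridge G d -> A) :
  \sum_(F : {set facet G d}) \sum_(R : {set ridge G d})
     \sum_(phi : {ffun {r in ~: R} -> {f in F}})
     \sum_(phi' : {ffun {r in ~: R} -> {f in F}}
           | bidirected_rooted_forest K phi phi')
       c (Lambda K phi * Lambda K phi')
       * (\prod_(r : {r in ~: R}) w (val r) (val (phi r)))
       * (\prod_(r in R) x r) =
  \det ((\matrix_(i < #|[set: ridge G d]|, j < #|[set: facet G d]|)
          (w (enum_val i) (enum_val j) * c (boundary K G d i j)))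
        *m (map_mx c (boundary K G d))^T
        + diag_mx (\row_(i < #|[set: ridge G d]|) x (enum_val i))).
Proof.
rewrite exchange_big /=.
transitivity (fdet (fun r s : ridge G d =>
    \sum_f (w r f * c (incidence K (val r) (val f))) *
           c (incidence K (val s) (val f))
    + x r *+ (r == s))).
  rewrite fdet_add_diag; apply: eq_bigr => R _.
  rewrite fdet_Cauchy_Binet mulr_suml; apply: eq_bigr => F _.
  rewrite -sum_bidirected mulr_suml; apply: eq_bigr => phi _.
  by rewrite mulr_suml.
rewrite -(fdetE (e := @enum_val _ (mem [set: ridge G d]))) ?cardsT //;
  last exact: enum_val_inj.
congr (\det _); apply/matrixP => i j; rewrite !mxE (inj_eq enum_val_inj).
congr (_ + _).
under eq_bigl => f do rewrite -(in_setT f).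
by rewrite big_enum_val; apply: eq_bigr => f _; rewrite !mxE.
Qed.

Theorem theorem32 (K : realType) (n : nat) (G : {set {set 'I_n}}) (d : nat)
    (complexG : simplicial_complex G) (dimG : complex_dim G d) :
  (\sum_(F : {set facet G d}) \sum_(R : {set ridge G d})
     \sum_(phi : {ffun {r in ~: R} -> {f in F}})
     \sum_(phi' : {ffun {r in ~: R} -> {f in F}}
           | bidirected_rooted_forest K phi phi')
       (Lambda K phi * Lambda K phi')%:P * 'X^#|R|
   = \det (map_mx polyC (laplacian K G d) + 'X%:M :> 'M[{poly K}]_(_)))
  /\
  (\sum_(F : {set facet G d}) \sum_(R : {set ridge G d})
     \sum_(phi : {ffun {r in ~: R} -> {f in F}})
     \sum_(phi' : {ffun {r in ~: R} -> {f in F}}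
           | bidirected_rooted_forest K phi phi')
       (Lambda K phi * Lambda K phi')%:MP
       * (\prod_(r : {r in ~: R}) wvar K (val r) (val (phi r)))
       * (\prod_(r in R) xvar K r)
   = \det (weighted_laplacian K G d + xdiag K G d)).
Proof.
split; last first.
  exact: (sum_bidirected_det (@mpolyC _ K) (@wvar K n G d) (@xvar K n G d)).
(* The univariate identity is the case of all weights 1 and all diagonal entries ['X]. *)
apply: etrans
  (etrans (sum_bidirected_det (@polyC K) (fun _ _ => 1) (fun _ => 'X)) _).
  do 3! apply: eq_bigr => ? _; apply: eq_bigr => phi' _.
  by rewrite big1_eq mulr1 prodr_const.
rewrite /laplacian map_mxM map_trmx -diag_const_mx.
by congr (\det (_ *m _ + _)); apply/matrixP => i j; rewrite !mxE ?mul1r.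
Qed.
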